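(* Let $\mathscr T=(V,\mathcal E)$ be the directed Cartesian product of rooted directed trees $\mathscr T_1,\ldots,\mathscr T_d$ and let $S_{\lambda}=(S_1,\ldots,S_d)$ be a commuting multishift on $\mathscr T$ with weights $\{\lambda_v^{(j)} : v\in V\setminus\{\mathsf{root}\},\ j=1,\ldots,d\}$. Then $S_\lambda$ is unitarily equivalent to a commuting operator-valued multishift.
   Context: $\mathbb N$ is the set of non-negative integers, $d\ge 1$, and $\varepsilon_j\in\mathbb N^d$ has $1$ in the $j$th place and $0$ elsewhere. Trees and multishifts on trees. A rooted directed tree $\mathscr T_j=(V_j,\mathcal E_j)$ is a directed graph with countable vertex set $V_j$ and edge set $\mathcal E_j\subseteq V_j\times V_j$ that has no circuits, is connected (as an undirected graph), and has a vertex $\mathsf{root}_j$ with no incoming edge such that every other vertex $v$ has exactly one parent $\mathsf{par}(v)$, i.e. exactly one $u$ with $(u,v)\in\mathcal E_j$. The directed Cartesian product of $\mathscr T_1,\dots,\mathscr T_d$ is the directed graph $\mathscr T=(V,\mathcal E)$ with $V=V_1\times\cdots\times V_d$ and $(v,w)\in\mathcal E$ if and only if there is $k$ with $(v_k,w_k)\in\mathcal E_k$ and $v_l=w_l$ for all $l\ne k$; $\mathsf{root}=(\mathsf{root}_1,\dots,\mathsf{root}_d)$. For $v\in V$ with $v_j\neq\mathsf{root}_j$, let $\mathsf{par}_j(v)$ be obtained from $v$ by replacing $v_j$ with its parent in $\mathscr T_j$. Given complex numbers $\lambda_v^{(j)}$, the multishift $S_\lambda=(S_1,\dots,S_d)$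 on $\mathscr T$ consists of the operators in $\ell^2(V)$ given by $(S_jf)(v)=\lambda_v^{(j)}f(\mathsf{par}_j(v))$ if $v_j\ne \mathsf{root}_j$ and $(S_jf)(v)=0$ otherwise. It is called commuting if each $S_j$ is a bounded operator on $\ell^2(V)$ and $S_iS_j=S_jS_i$ for all $i,j$. Operator-valued multishifts. Let $\{H_\alpha:\alpha\in\mathbb N^d\}$ be complex separable Hilbert spaces, $\mathcal H=\oplus_{\alpha\in\mathbb N^d}H_\alpha$ their orthogonal direct sum, and $A^{(j)}_\alpha:H_\alpha\to H_{\alpha+\varepsilon_j}$ bounded linear operators ($\alpha\in\mathbb N^d$, $j=1,\dots,d$). The operator-valued multishift on $\mathcal H$ with operator weights $\{A^{(j)}_\alpha\}$ is the $d$-tuple $T=(T_1,\dots,T_d)$ given by $T_j(\oplus_\alpha x_\alpha)=\oplus_\alpha A^{(j)}_{\alpha-\varepsilon_j}x_{\alpha-\varepsilon_j}$, where the $\alpha$-entry is $0$ if $\alpha_j=0$. It is called commuting if $\sup_\alpha\|A^{(j)}_\alpha\|<\infty$ for every $j$ (equivalently each $T_j$ is bounded on $\mathcal H$) and $A^{(i)}_{\alpha+\varepsilon_j}A^{(j)}_\alpha=A^{(j)}_{\alpha+\varepsilon_i}A^{(i)}_\alpha$ for all $\alpha,i,j$ (equivalently the $T_j$ commute). Two $d$-tuples $S$ on $\mathcal K$ and $T$ on $\mathcal H$ are unitarily equivalent if there is a unitary $U:\mathcal K\to\mathcal H$ with $US_j=T_jU$ for all $j$. *)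

(* Defs.v *)
From HB Require Import structures.
From mathcomp Require Import all_boot all_order all_algebra finmap sesquilinear.
From mathcomp Require Import all_classical all_reals ereal topology normedtype esum.
From mathcomp Require Import complex ring.
From mathcomp.analysis.showcase Require summability.

Set Implicit Arguments.
Unset Strict Implicit.
Unset Printing Implicit Defensive.

Import Order.TTheory GRing.Theory Num.Theory.
Import numFieldNormedType.Exports.

Local Open Scope classical_set_scope.
Local Open Scope ring_scope.

(* [totally] is the filter of eventually large finite index sets, so that
   [summability.sum] is the unconditional sum of a family. *)
#[global] Existing Instance summability.totally_filter.

(* The complex numbers as a normed space over themselves, with the modulus. *)
HB.instance Definition _ (R : realType) := NormedModule.copy R[i] R[i]^o.

Section CompleteComplex.
Variable R : realType.

Lemma ImRe_norm_le (z : R[i]) : `|z| <= (`|complex.Re z| + `|complex.Im z|)%:C%C.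
Proof.
rewrite [z in leLHS]complexE (le_trans (ler_normD _ _))// rmorphD/= normrM.
have n1 (r : R) : `|r%:C%C| = `|r|%:C%C :> R[i] by rewrite normc_def/= expr0n/= addr0 sqrtr_sqr.
have -> : `|'i%C| = 1 :> R[i] by rewrite normc_def/= expr0n expr1n/= add0r sqrtr1.
by rewrite mul1r !n1.
Qed.

Lemma Re_norm_le (z : R[i]) : `|complex.Re z| <= complex.Re `|z|.
Proof.
by have := normc_ge_Re z; rewrite lecE/= => /andP[].
Qed.

Lemma Im_norm_le (z : R[i]) : `|complex.Im z| <= complex.Re `|z|.
Proof.
by have := Re_norm_le (z * 'i%C); rewrite ReiNIm normrN normrM (_ : `|'i%C| = 1) ?mulr1//
   normc_def/= expr0n expr1n/= add0r sqrtr1.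
Qed.

Lemma posC (e : R[i]) : 0 < e -> exists2 d : R, 0 < d & e = d%:C%C.
Proof.
case: e => a b; rewrite ltcE/= => /andP[/eqP-> a0]; by exists a.
Qed.

Lemma complex_complete (F : set_system R[i]) :
  ProperFilter F -> cauchy F -> cvg F.
Proof.
move=> FF /cauchy_ballP Fc; apply/cvg_ex.
have part (p : R[i] -> R) : (forall x y, p (x - y) = p x - p y) ->
    (forall x, `|p x| <= complex.Re `|x|) -> cvg (p @ F).
  move=> pB ple; apply: cauchy_cvg; apply/cauchy_ballP => e e0.
  have eC : 0 < e%:C%C :> R[i] by rewrite ltcR.
  rewrite near_map2.
  apply: (@filterS _ (filter_prod F F) _ _ _ _ (Fc _ eC)) => -[x y].
  rewrite -ball_normE/= ltcE/= => /andP[_]; rewrite /ball/= -pB.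
  exact/le_lt_trans/ple.
have /cvg_ex[a Fa] := part (@complex.Re R) (fun x y => raddfB (@complex.Re R : Rcomplex R -> R) x y) Re_norm_le.
have /cvg_ex[b Fb] := part (@complex.Im R) (fun x y => raddfB (@complex.Im R : Rcomplex R -> R) x y) Im_norm_le.
exists (a +i* b)%C; apply/cvgrPdist_le => /= e /posC[d d0 ->].
have d2 : 0 < d / 2 by rewrite divr_gt0.
move/cvgrPdist_le : Fa => /(_ _ d2) Fa; move/cvgrPdist_le : Fb => /(_ _ d2) Fb.
near=> z; rewrite (le_trans (ImRe_norm_le _))// lecR [leRHS](splitr d) lerD//.
  rewrite (raddfB (@complex.Re R : Rcomplex R -> R))/=; near: z; exact: Fa.
rewrite (raddfB (@complex.Im R : Rcomplex R -> R))/=; near: z; exact: Fb.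
Unshelve. all: by end_near. Qed.

HB.instance Definition _ := Uniform_isComplete.Build R[i] complex_complete.

End CompleteComplex.

Section CauchySchwarz.
Variables (C : numClosedFieldType) (U : lmodType C) (form : {dot U for Num.conj}).
Local Notation "''[' u , v ]" := (form u v) : ring_scope.

Lemma dot_CauchySchwarz (u v : U) : `|'[u, v]| ^+ 2 <= '[u, u] * '[v, v].
Proof.
have [->|v0] := eqVneq v 0; first by rewrite !linear0r normr0 expr0n mulr0.
have vv : 0 < '[v, v] by rewrite neq0_dnorm_gt0.
have vvJ : '[v, v]^* = '[v, v] by apply/CrealP; rewrite ger0_real ?ltW.
have := dnorm_ge0 form ('[v, v] *: u - '[u, v] *: v).
rewrite !(linearBl, linearBr)/= !linearZl_LR/= !linearZr_LR/= vvJ.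
have -> : '[v, u] = '[u, v]^* by rewrite [LHS]hermC/= expr0 mul1r.
rewrite [_ ^+ 2]normCK.
have -> : '[v, v] * ('[v, v] * '[u, u]) - '[v, v] * ('[u, v]^* * '[u, v]) -
  ('[u, v] * ('[v, v] * '[u, v]^*) - '[u, v] * ('[u, v]^* * '[v, v])) =
  '[v, v] * ('[u, u] * '[v, v] - '[u, v] * '[u, v]^*).
  rewrite [X in _ - X](_ : _ = 0) ?subr0; last first.
    by rewrite [X in _ * X - _]mulrC subrr.
  by rewrite mulrBr; congr (_ * _ - _ * _); exact: mulrC.
by rewrite pmulr_rge0// subr_ge0.
Qed.

Lemma dot_norm_le (u v : U) : `|'[u, v]| <= '[u, u] + '[v, v].
Proof.
have h0 : 0 <= '[u, u] + '[v, v] by rewrite addr_ge0 ?dnorm_ge0.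
rewrite -(@ler_pXn2r _ 2)// ?nnegrE//.
rewrite (le_trans (dot_CauchySchwarz u v))// sqrrD mulr2n -!addrA addrCA lerDl.
by rewrite !addr_ge0// ?mulr_ge0// ?exprn_ge0// dnorm_ge0.
Qed.

Lemma dot_triangle (u v : U) :
  sqrtC '[u + v, u + v] <= sqrtC '[u, u] + sqrtC '[v, v].
Proof.
have s0 (w : U) : 0 <= sqrtC '[w, w] by rewrite sqrtC_ge0 dnorm_ge0.
rewrite -(@ler_pXn2r _ 2)// ?nnegrE// ?addr_ge0//.
rewrite sqrrD !sqrtCK dnormD addrAC lerD2r lerD2l.
have -> : '[u, v] + '[u, v]^* = ('Re '[u, v]) *+ 2.
  by rewrite ReE -mulr_natr divfK ?pnatr_eq0.
rewrite lerMn2r/=.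
have : `|'[u, v]| <= sqrtC '[u, u] * sqrtC '[v, v].
  rewrite -(@ler_pXn2r _ 2)// ?nnegrE// ?mulr_ge0//.
  by rewrite exprMn !sqrtCK dot_CauchySchwarz.
by apply: le_trans; rewrite leif_Re_Creal.
Qed.

End CauchySchwarz.

Section ComplexSum.
Variables (R : realType) (I : choiceType).
Implicit Types (u v : I -> R[i]) (A B : {fset I}).

Local Notation psum := (@summability.partial_sum I _).

Lemma partial_sumE (V : zmodType) (u : I -> V) A :
  summability.partial_sum u A = \sum_(i <- A) u i.
Proof. by rewrite big_seq_fsetE. Qed.

Lemma fsum_sub (V : zmodType) (u : I -> V) A B : (A `<=` B)%fset ->
  \sum_(i <- B) u i - \sum_(i <- A) u i = \sum_(i <- (B `\` A)%fset) u i.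
Proof.
move=> AB; rewrite (big_fsetID _ (mem A) B)/=.
have -> : [fset x in B | x \in A]%fset = A.
  by apply/fsetP => x; rewrite !inE/= andbC; have [/(fsubsetP AB)->|] := boolP (x \in A).
apply/eqP; rewrite subr_eq [eqbRHS]addrC; apply/eqP; congr (_ + _); by apply: eq_fbigl => i; rewrite !inE/= andbC.
Qed.

Lemma fsum_le_sub (u : I -> R) A B : (forall i, 0 <= u i) -> (A `<=` B)%fset ->
  \sum_(i <- A) u i <= \sum_(i <- B) u i.
Proof. by move=> u0 AB; rewrite -subr_ge0 fsum_sub// sumr_ge0. Qed.

Lemma Re_fsum (u : I -> R[i]) A :
  complex.Re (\sum_(i <- A) u i) = \sum_(i <- A) complex.Re (u i).
Proof. exact: (raddf_sum (@complex.Re R : Rcomplex R -> R)). Qed.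

Lemma abs_cvg_sum u (M : R) :
  (forall A, \sum_(i <- A) complex.Re `|u i| <= M) ->
  cvg (summability.partial_sum u @ summability.totally).
Proof.
move=> uM; apply: cauchy_cvg; apply/cauchy_exP => e /posC[d d0 ->{e}].
pose a i := complex.Re `|u i|.
have a0 i : 0 <= a i by rewrite (le_trans (normr_ge0 _) (Re_norm_le _)).
pose S := [set \sum_(i <- A) a i | A in [set: {fset I}]].
have supS : has_sup S.
  split; first by exists (\sum_(i <- fset0) a i), fset0.
  by exists M => _ [A _ <-]; exact: uM.
have [_ [A _ <-] As] := sup_adherent d0 supS.
exists (summability.partial_sum u A); exists A => //= B AB.
rewrite -ball_normE/= !partial_sumE distrC fsum_sub//.
rewrite (le_lt_trans (ler_norm_sum _ _ _))//.
have -> : \sum_(i <- (B `\` A)%fset) `|u i| = (\sum_(i <- (B `\` A)%fset) a i)%:C%C.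
  rewrite rmorph_sum/=; apply: eq_bigr => i _.
  by rewrite /a RRe_real// normr_real.
rewrite ltcR -fsum_sub// ltrBlDr.
have : \sum_(i <- B) a i <= sup S by apply: ub_le_sup; [case: supS|exists B].
by move=> /le_lt_trans; apply; rewrite -ltrBlDl.
Qed.

Lemma cvg_sumP u : cvg (summability.partial_sum u @ summability.totally) ->
  summability.partial_sum u @ summability.totally --> summability.sum u.
Proof. by []. Qed.

Lemma sum_lim u (l : R[i]) :
  summability.partial_sum u @ summability.totally --> l ->
  summability.sum u = l.
Proof. by move=> ul; apply/cvg_lim. Qed.

End ComplexSum.

(* Inner products are linear in the first argument. *)
HB.mixin Record NormedModule_isHilbert (R : realType) H
    & NormedModule R[i] H := {
  hdot : {dot H for (@Num.conj R[i])};
  hdot_norm : forall x : H, hdot x x = `|x| ^+ 2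
}.

#[short(type="hilbertType")]
HB.structure Definition Hilbert (R : realType) :=
  {H of CompleteNormedModule R[i] H & NormedModule_isHilbert R H}.

Local Notation "''[' x , y ]" := (hdot x y) : ring_scope.

(* The norm [`|x|] of a complex normed space lives in R[i]; [rnorm x] is the
   same nonnegative number seen in R. *)
Definition rnorm (R : realType) (V : normedModType R[i]) (x : V) : R :=
  complex.Re `|x|.

Section RealNorm.
Variables (R : realType).

Lemma rnormE (V : normedModType R[i]) (x : V) : `|x| = (rnorm x)%:C%C.
Proof. by rewrite RRe_real// normr_real. Qed.

Lemma rnorm_ge0 (V : normedModType R[i]) (x : V) : 0 <= rnorm x.
Proof. by rewrite -ler0c -rnormE. Qed.

Lemma rnormD (V : normedModType R[i]) (x y : V) : rnorm (x + y) <= rnorm x + rnorm y.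
Proof. by rewrite -lecR rmorphD/= -!rnormE ler_normD. Qed.

Lemma rnormN (V : normedModType R[i]) (x : V) : rnorm (- x) = rnorm x.
Proof. by rewrite /rnorm normrN. Qed.

Lemma rnormZ (V : normedModType R[i]) (a : R[i]) (x : V) :
  rnorm (a *: x) = complex.Re `|a| * rnorm x.
Proof.
by apply: complexI; rewrite -rnormE normrZ rmorphM/= RRe_real ?normr_real// -rnormE.
Qed.

Lemma Re_dist_le (z w : R[i]) (d : R) :
  `|z - w| <= d%:C%C -> `|complex.Re z - complex.Re w| <= d.
Proof.
move=> zw; rewrite -(raddfB (@complex.Re R : Rcomplex R -> R)).
by rewrite (le_trans (Re_norm_le _))// -lecR RRe_real ?normr_real.
Qed.

Lemma Im_dist_le (z w : R[i]) (d : R) :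
  `|z - w| <= d%:C%C -> `|complex.Im z - complex.Im w| <= d.
Proof.
move=> zw; rewrite -(raddfB (@complex.Im R : Rcomplex R -> R)).
by rewrite (le_trans (Im_norm_le _))// -lecR RRe_real ?normr_real.
Qed.

Lemma hdot_rnorm (H : hilbertType R) (x : H) : '[x, x] = (rnorm x ^+ 2)%:C%C.
Proof. by rewrite hdot_norm rnormE rmorphXn. Qed.

Lemma rnorm_hdot_le (H : hilbertType R) (x y : H) :
  complex.Re `|'[x, y]| <= rnorm x ^+ 2 + rnorm y ^+ 2.
Proof.
rewrite -lecR RRe_real ?normr_real// rmorphD/= -!hdot_rnorm.
exact: dot_norm_le.
Qed.

Lemma rnormD_sqr_le (V : normedModType R[i]) (x y : V) :
  rnorm (x + y) ^+ 2 <= 2 * rnorm x ^+ 2 + 2 * rnorm y ^+ 2.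
Proof.
have h : rnorm (x + y) ^+ 2 <= (rnorm x + rnorm y) ^+ 2.
  by rewrite ler_pXn2r ?nnegrE ?addr_ge0 ?rnorm_ge0// rnormD.
rewrite (le_trans h)// -subr_ge0.
have -> : 2 * rnorm x ^+ 2 + 2 * rnorm y ^+ 2 - (rnorm x + rnorm y) ^+ 2 =
  (rnorm x - rnorm y) ^+ 2 by ring.
exact: sqr_ge0.
Qed.

End RealNorm.

Lemma esum_ltyP (R : realType) (I : choiceType) (f : I -> R) :
  ((\esum_(i in [set: I]) (f i)%:E < +oo)%E <->
   exists M : R, forall A : {fset I}, \sum_(i <- A) f i <= M).
Proof.
split=> [foo|[M fM]].
  exists (fine (\esum_(i in [set: I]) (f i)%:E)%E) => A.
  have h : ((\sum_(i <- A) f i)%:E <= \esum_(i in [set: I]) (f i)%:E)%E.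
    apply: ereal_sup_ubound; exists [set` A]; first by split.
    by rewrite fsbig_finite//= set_fsetK sumEFin.
  rewrite -lee_fin fineK// fin_numE; apply/andP; split; last by rewrite lt_eqF.
  by rewrite gt_eqF// (lt_le_trans _ h)// ltNyr.
apply: (@le_lt_trans _ _ M%:E); last exact: ltry.
apply: ge_ereal_sup => _ [A [finA _] <-].
by rewrite fsbig_finite//= sumEFin lee_fin.
Qed.

Lemma cvg_rnorm (R : realType) (V : normedModType R[i]) (T : Type)
    (F : set_system T) (FF : Filter F) (f : T -> V) (a : V) :
  f @ F --> a -> (fun x => rnorm (f x)) @ F --> rnorm a.
Proof.
move=> /cvgrPdist_le fa; apply/cvgrPdist_le => e e0.
have eC : 0 < e%:C%C :> R[i] by rewrite ltcR.
apply: filterS (fa _ eC) => x; rewrite rnormE lecR; apply: le_trans.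
rewrite ler_norml lerBlDr lerNl opprB lerBlDr.
have h (u v : V) : rnorm u <= rnorm (u - v) + rnorm v.
  by rewrite -{1}(subrK v u) rnormD.
by rewrite h -(rnormN (a - f x)) opprB h.
Qed.

Section HilbertSum.
Variables (R : realType) (I : choiceType) (H : I -> hilbertType R).

(* The orthogonal direct sum: families [x i] in [H i] such that the sum of the
   [rnorm (x i) ^+ 2] is finite. *)
Record hsum := HSum {
  hsum_fun :> forall i, H i;
  hsum_sqr : (\esum_(i in [set: I]) (rnorm (hsum_fun i) ^+ 2)%:E < +oo)%E
}.

Lemma hsum_bound (x : hsum) : exists M : R, forall A : {fset I},
  \sum_(i <- A) rnorm (x i) ^+ 2 <= M.
Proof. exact/esum_ltyP/hsum_sqr. Qed.

Lemma hsum_ext (x y : hsum) : (forall i, x i = y i) -> x = y.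
Proof.
case: x y => [x xP] [y yP] /= xy.
have {}xy : x = y by apply: functional_extensionality_dep.
by subst y; congr HSum; exact: Prop_irrelevance.
Qed.

HB.instance Definition _ := gen_eqMixin hsum.
HB.instance Definition _ := gen_choiceMixin hsum.

Fact hsum0_subproof :
  (\esum_(i in [set: I]) (rnorm (0 : H i) ^+ 2)%:E < +oo)%E.
Proof.
apply/esum_ltyP; exists 0 => A; rewrite big1// => i _.
by rewrite /rnorm normr0 expr0n.
Qed.

Fact hsumN_subproof (x : hsum) :
  (\esum_(i in [set: I]) (rnorm (- x i) ^+ 2)%:E < +oo)%E.
Proof.
have [M xM] := hsum_bound x; apply/esum_ltyP; exists M => A.
by under eq_bigr do rewrite rnormN; exact: xM.
Qed.

Fact hsumD_subproof (x y : hsum) :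
  (\esum_(i in [set: I]) (rnorm (x i + y i) ^+ 2)%:E < +oo)%E.
Proof.
have [M xM] := hsum_bound x; have [N yN] := hsum_bound y.
apply/esum_ltyP; exists (2 * M + 2 * N) => A.
rewrite (le_trans (ler_sum _ (fun i _ => rnormD_sqr_le (x i) (y i))))//.
by rewrite big_split/= -!mulr_sumr lerD// ler_pM2l.
Qed.

Fact hsumZ_subproof (a : R[i]) (x : hsum) :
  (\esum_(i in [set: I]) (rnorm (a *: x i) ^+ 2)%:E < +oo)%E.
Proof.
have [M xM] := hsum_bound x; apply/esum_ltyP.
exists ((complex.Re `|a|) ^+ 2 * M) => A.
under eq_bigr do rewrite rnormZ exprMn.
by rewrite -mulr_sumr ler_wpM2l// exprn_ge0// (le_trans _ (Re_norm_le _)).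
Qed.

Let hsum0 := HSum hsum0_subproof.
Let hsumN x := HSum (hsumN_subproof x).
Let hsumD x y := HSum (hsumD_subproof x y).
Let hsumZ a x := HSum (hsumZ_subproof a x).

Fact hsum_addA : associative hsumD.
Proof. by move=> x y z; apply: hsum_ext => i; exact: addrA. Qed.
Fact hsum_addC : commutative hsumD.
Proof. by move=> x y; apply: hsum_ext => i; exact: addrC. Qed.
Fact hsum_add0 : left_id hsum0 hsumD.
Proof. by move=> x; apply: hsum_ext => i; exact: add0r. Qed.
Fact hsum_addN : left_inverse hsum0 hsumN hsumD.
Proof. by move=> x; apply: hsum_ext => i; exact: addNr. Qed.

HB.instance Definition _ := GRing.isZmodule.Build hsum
  hsum_addA hsum_addC hsum_add0 hsum_addN.

Fact hsum_scaleA (a b : R[i]) (x : hsum) : hsumZ a (hsumZ b x) = hsumZ (a * b) x.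
Proof. by apply: hsum_ext => i; exact: scalerA. Qed.
Fact hsum_scale1 : left_id 1 hsumZ.
Proof. by move=> x; apply: hsum_ext => i; exact: scale1r. Qed.
Fact hsum_scaleDr : right_distributive hsumZ +%R.
Proof. by move=> a x y; apply: hsum_ext => i; exact: scalerDr. Qed.
Fact hsum_scaleDl (x : hsum) : {morph hsumZ^~ x : a b / a + b}.
Proof. by move=> a b; apply: hsum_ext => i; exact: scalerDl. Qed.

HB.instance Definition _ := GRing.Zmodule_isLmodule.Build R[i] hsum
  hsum_scaleA hsum_scale1 hsum_scaleDr hsum_scaleDl.

Lemma hsumDE (x y : hsum) i : (x + y) i = x i + y i. Proof. by []. Qed.
Lemma hsumNE (x : hsum) i : (- x) i = - x i. Proof. by []. Qed.
Lemma hsum0E i : (0 : hsum) i = 0. Proof. by []. Qed.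
Lemma hsumZE a (x : hsum) i : (a *: x) i = a *: x i. Proof. by []. Qed.

(* This sum converges absolutely, see [hsum_dot_cvg]; the norm is the one
   induced by [hsum_dot], see [hsum_normE]. *)
Definition hsum_dot (x y : hsum) : R[i] :=
  summability.sum (fun i => '[x i, y i] : R[i]).

Lemma hsum_dot_cvg (x y : hsum) :
  summability.partial_sum (fun i => '[x i, y i] : R[i]) @ summability.totally
    --> hsum_dot x y.
Proof.
have [M xM] := hsum_bound x; have [N yN] := hsum_bound y.
apply/cvg_sumP/(@abs_cvg_sum _ _ _ (M + N)) => A.
rewrite (le_trans (ler_sum _ (fun i _ => rnorm_hdot_le (x i) (y i))))//.
by rewrite big_split/= lerD.
Qed.

Lemma partial_sum_lin (K : pzRingType) (V : lmodType K) (a : K) (u v : I -> V) :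
  summability.partial_sum (fun i => a *: u i + v i) =
  (fun A => a *: summability.partial_sum u A + summability.partial_sum v A).
Proof.
apply/funext => A; rewrite /summability.partial_sum big_split/=.
by rewrite scaler_sumr.
Qed.

Fact hsum_dot_linearl (y : hsum) (a : R[i]) (u v : hsum) :
  hsum_dot (a *: u + v) y = a * hsum_dot u y + hsum_dot v y.
Proof.
apply: sum_lim.
rewrite [X in summability.partial_sum X](_ : _ =
    fun i => a *: ('[u i, y i] : R[i]) + '[v i, y i]); last first.
  by apply/funext => i; rewrite hsumDE hsumZE linearDl/= linearZl_LR.
rewrite partial_sum_lin; apply: cvgD; last exact: hsum_dot_cvg.
by apply: cvgZr; exact: hsum_dot_cvg.
Qed.

Fact hsum_dotC (x y : hsum) : hsum_dot x y = (hsum_dot y x)^*.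
Proof.
apply: sum_lim.
have -> : summability.partial_sum (fun i => '[x i, y i] : R[i]) =
  (fun A => (summability.partial_sum (fun i => '[y i, x i] : R[i]) A)^*).
  apply/funext => A; rewrite /summability.partial_sum rmorph_sum/=.
  by apply: eq_bigr => i _; rewrite [LHS]hermC/= expr0 mul1r.
apply/cvgrPdist_le => e e0.
have /cvgrPdist_le/(_ e e0) := @hsum_dot_cvg y x.
by apply: filterS => A; rewrite -rmorphB norm_conjC.
Qed.

Lemma partial_sum_dot (x : hsum) (A : {fset I}) :
  summability.partial_sum (fun i => '[x i, x i] : R[i]) A =
  (\sum_(i <- A) rnorm (x i) ^+ 2)%:C%C.
Proof.
rewrite partial_sumE rmorph_sum/=; apply: eq_bigr => i _.
by rewrite hdot_rnorm.
Qed.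

Lemma hsum_dot_ge (x : hsum) (A : {fset I}) :
  (\sum_(i <- A) rnorm (x i) ^+ 2)%:C%C <= hsum_dot x x.
Proof.
set s := \sum_(i <- A) _; set l := hsum_dot x x.
have lim := @hsum_dot_cvg x x.
have near_ge e : 0 < e -> exists2 t : R, s <= t & `|l - t%:C%C| <= e.
  move=> e0; have /cvgrPdist_le/(_ e e0)[B _ BP] := lim.
  exists (\sum_(i <- (A `|` B)%fset) rnorm (x i) ^+ 2).
    apply: fsum_le_sub; last exact: fsubsetUl.
    by move=> i; rewrite exprn_ge0// rnorm_ge0.
  by rewrite -partial_sum_dot; apply: BP; exact: fsubsetUr.
rewrite lecE/=; apply/andP; split.
  apply: contraT => ln0.
  have e0 : 0 < `|complex.Im l| / 2 by rewrite divr_gt0// normr_gt0.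
  have eC : 0 < (`|complex.Im l| / 2)%:C%C :> R[i] by rewrite ltcR.
  have [t _ tl] := near_ge _ eC.
  have : `|complex.Im l| <= `|complex.Im l| / 2.
    by have := Im_dist_le tl; rewrite subr0.
  by rewrite leNgt ltr_pdivrMr// ltr_pMr ?ltr1n ?normr_gt0.
rewrite leNgt; apply/negP => ls.
have e0 : 0 < (s - complex.Re l) / 2 by rewrite divr_gt0// subr_gt0.
have eC : 0 < ((s - complex.Re l) / 2)%:C%C :> R[i] by rewrite ltcR.
have [t st tl] := near_ge _ eC.
have : s - complex.Re l <= (s - complex.Re l) / 2.
  rewrite (le_trans (lerB st (lexx _)))//.
  by rewrite (le_trans (ler_norm _))// distrC; exact: Re_dist_le tl.
by rewrite leNgt ltr_pdivrMr// ltr_pMr ?ltr1n ?subr_gt0.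
Qed.

Lemma hsum_dot_le (x : hsum) (M : R) :
  (forall A : {fset I}, \sum_(i <- A) rnorm (x i) ^+ 2 <= M) ->
  hsum_dot x x <= M%:C%C.
Proof.
move=> xM; set l := hsum_dot x x.
have l0 : 0 <= l by have := hsum_dot_ge x fset0; rewrite big_seq_fset0.
have lE : l = (complex.Re l)%:C%C by rewrite RRe_real// ger0_real.
rewrite lE lecR leNgt; apply/negP => Ml.
have e0 : 0 < (complex.Re l - M) / 2 by rewrite divr_gt0// subr_gt0.
have eC : 0 < ((complex.Re l - M) / 2)%:C%C :> R[i] by rewrite ltcR.
have /cvgrPdist_le/(_ _ eC)[B _ /(_ B (fsubset_refl _))] := @hsum_dot_cvg x x.
rewrite partial_sum_dot -/l => h.
have : complex.Re l - M <= (complex.Re l - M) / 2.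
  rewrite (le_trans (lerB (lexx _) (xM B)))//.
  by rewrite (le_trans (ler_norm _))//; exact: Re_dist_le h.
by rewrite leNgt ltr_pdivrMr// ltr_pMr ?ltr1n ?subr_gt0.
Qed.


Lemma hsum_dot_linearr (x : hsum) (a : R[i]) (u v : hsum) :
  hsum_dot x (a *: u + v) = a^* * hsum_dot x u + hsum_dot x v.
Proof.
by rewrite hsum_dotC hsum_dot_linearl rmorphD rmorphM/= -!hsum_dotC.
Qed.

Fact hsum_dot_bilinear :
  bilinear_for (GRing.Scale.Law.clone _ _ *%R _)
    (GRing.Scale.Law.clone _ _ (@Num.conj R[i] \; *%R) _) hsum_dot.
Proof.
by split=> [y|x] a u v; [exact: hsum_dot_linearl | exact: hsum_dot_linearr].
Qed.

HB.instance Definition _ := bilinear_isBilinear.Build R[i] hsum hsum R[i] _ _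
  hsum_dot hsum_dot_bilinear.

Fact hsum_dot_hermitian (x y : hsum) :
  hsum_dot x y = (-1) ^+ false * (hsum_dot y x)^*.
Proof. by rewrite expr0 mul1r hsum_dotC. Qed.

HB.instance Definition _ := isHermitianSesquilinear.Build R[i] hsum false
  (@Num.conj R[i]) hsum_dot hsum_dot_hermitian.

Fact hsum_dot_gt0 (x : hsum) : x != 0 -> 0 < hsum_dot x x.
Proof.
move=> x0; have [i xi0] : exists i, x i != 0.
  apply: contrapT => /forallNP x'; move/eqP: x0; apply; apply: hsum_ext => i.
  by have /negP := x' i; rewrite negbK => /eqP.
rewrite (lt_le_trans _ (hsum_dot_ge x [fset i]%fset))// big_seq_fset1 -hdot_rnorm.
by rewrite neq0_dnorm_gt0.
Qed.

HB.instance Definition _ := isDotProduct.Build R[i] hsum hsum_dot hsum_dot_gt0.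

Definition hsum_norm (x : hsum) : R[i] := sqrtC (hsum_dot x x).

Fact hsum_normD (x y : hsum) : hsum_norm (x + y) <= hsum_norm x + hsum_norm y.
Proof. exact: dot_triangle. Qed.

Fact hsum_normZ (a : R[i]) (x : hsum) : hsum_norm (a *: x) = `|a| * hsum_norm x.
Proof.
rewrite /hsum_norm dnormZ sqrtCM ?nnegrE ?exprn_ge0 ?dnorm_ge0//.
by rewrite sqrCK.
Qed.

Fact hsum_norm_eq0 (x : hsum) : hsum_norm x = 0 -> x = 0.
Proof. by move/eqP; rewrite sqrt_dnorm_eq0 => /eqP. Qed.

HB.instance Definition _ := Lmodule_isNormed.Build R[i] hsum
  hsum_normD hsum_normZ hsum_norm_eq0.

Lemma hsum_normE (x : hsum) : hsum_dot x x = `|x| ^+ 2.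
Proof. by rewrite [RHS]sqrtCK. Qed.

Lemma hsum_norm_ge (x : hsum) (A : {fset I}) :
  \sum_(i <- A) rnorm (x i) ^+ 2 <= rnorm x ^+ 2.
Proof.
by rewrite -lecR rmorphXn/= -rnormE -hsum_normE hsum_dot_ge.
Qed.

Lemma hsum_norm_le (x : hsum) (M : R) : 0 <= M ->
  (forall A : {fset I}, \sum_(i <- A) rnorm (x i) ^+ 2 <= M ^+ 2) ->
  rnorm x <= M.
Proof.
move=> M0 xM; rewrite -(@ler_pXn2r _ 2)// ?nnegrE ?rnorm_ge0//.
by rewrite -lecR rmorphXn/= -rnormE -hsum_normE hsum_dot_le.
Qed.

Lemma hsum_coord_le (x : hsum) i : rnorm (x i) <= rnorm x.
Proof.
rewrite -(@ler_pXn2r _ 2)// ?nnegrE ?rnorm_ge0//.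
by have := hsum_norm_ge x [fset i]%fset; rewrite big_seq_fset1.
Qed.

Lemma hsum_complete (F : set_system hsum) : ProperFilter F -> cauchy F -> cvg F.
Proof.
move=> FF /cauchy_ballP Fc.
have coord i : cvg ((fun x : hsum => x i) @ F).
  apply: cauchy_cvg; apply/cauchy_ballP => e e0.
  rewrite near_map2.
  apply: (@filterS _ (filter_prod F F) _ _ _ _ (Fc _ e0)) => -[x y] /=.
  rewrite -!ball_normE/=; apply: le_lt_trans.
  by rewrite -hsumNE -hsumDE !rnormE lecR hsum_coord_le.
pose l i : H i := lim ((fun x : hsum => x i) @ F).
have key (e : R) : 0 < e -> exists2 z : hsum, F (ball z e%:C%C) &
    forall A : {fset I}, \sum_(i <- A) rnorm (l i - z i) ^+ 2 <= e ^+ 2.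
  move=> e0; have eC : 0 < e%:C%C :> R[i] by rewrite ltcR.
  have /cauchy_ballP/cauchyP/(_ _ eC)[z Fz] := Fc.
  exists z => // A; pose g (x : hsum) := \sum_(i <- A) rnorm (x i - z i) ^+ 2.
  have gl : g @ F --> \sum_(i <- A) rnorm (l i - z i) ^+ 2.
    rewrite /g; elim: (enum_fset A) => [|i r IH].
      by under eq_fun do rewrite big_nil; rewrite big_nil; exact: cvg_cst.
    under eq_fun do rewrite big_cons; rewrite big_cons; apply: cvgD => //.
    under eq_fun do rewrite expr2; rewrite expr2.
    have h : (fun x : hsum => rnorm (x i - z i)) @ F --> rnorm (l i - z i).
      by apply: cvg_rnorm; apply: cvgB; [exact: coord | exact: cvg_cst].
    exact: cvgM.
  refine (cvgr_to_le gl _).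
  apply: filterS Fz => x; rewrite -ball_normE/= distrC rnormE ltcR => xz.
  rewrite (le_trans (hsum_norm_ge (x - z) A))// ler_pXn2r ?nnegrE ?rnorm_ge0//.
  - exact: ltW.
  - exact: ltW.
have lP : (\esum_(i in [set: I]) (rnorm (l i) ^+ 2)%:E < +oo)%E.
  have [z _ zl] := key 1 ltr01; have [M zM] := hsum_bound z.
  apply/esum_ltyP; exists (2 * 1 ^+ 2 + 2 * M) => A.
  have h i : rnorm (l i) ^+ 2 <= 2 * rnorm (l i - z i) ^+ 2 + 2 * rnorm (z i) ^+ 2.
    by have := rnormD_sqr_le (l i - z i) (z i); rewrite subrK.
  rewrite (le_trans (ler_sum _ (fun i _ => h i)))//.
  by rewrite big_split/= -!mulr_sumr lerD// ler_pM2l.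
apply/cvg_ex; exists (HSum lP); apply/cvgrPdist_le => /= e /posC[d d0 ->{e}].
have d2 : 0 < d / 2 by rewrite divr_gt0.
have [z Fz zl] := key _ d2; apply: filterS Fz => x.
rewrite -ball_normE/= !rnormE ltcR lecR => zx.
rewrite -(subrK z (HSum lP)) -addrA (le_trans (rnormD _ _))// (splitr d).
by rewrite lerD ?(ltW zx)// hsum_norm_le// ltW.
Qed.

HB.instance Definition _ := Uniform_isComplete.Build hsum hsum_complete.

HB.instance Definition _ := NormedModule_isHilbert.Build R hsum hsum_normE.

End HilbertSum.

Section ComplexHilbert.
Variable R : realType.

Definition complex_dot (x y : R[i]) : R[i] := x * y^*.

Fact complex_dot_bilinear :
  bilinear_for (GRing.Scale.Law.clone _ _ *%R _)
    (GRing.Scale.Law.clone _ _ (@Num.conj R[i] \; *%R) _) complex_dot.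
Proof.
split=> [y|x] a u v; rewrite /complex_dot/=.
  by rewrite mulrDl -mulrA.
by rewrite rmorphD rmorphM/= mulrDr mulrCA.
Qed.

HB.instance Definition _ := bilinear_isBilinear.Build R[i] R[i] R[i] R[i] _ _
  complex_dot complex_dot_bilinear.

Fact complex_dot_hermitian (x y : R[i]) :
  complex_dot x y = (-1) ^+ false * (complex_dot y x)^*.
Proof. by rewrite expr0 mul1r /complex_dot rmorphM/= conjCK mulrC. Qed.

HB.instance Definition _ := isHermitianSesquilinear.Build R[i] R[i] false
  (@Num.conj R[i]) complex_dot complex_dot_hermitian.

Fact complex_dot_gt0 (x : R[i]) : x != 0 -> 0 < complex_dot x x.
Proof. by move=> x0; rewrite /complex_dot mul_conjC_gt0. Qed.

HB.instance Definition _ := isDotProduct.Build R[i] R[i] complex_dot complex_dot_gt0.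

Fact complex_dot_norm (x : R[i]) : complex_dot x x = `|x| ^+ 2.
Proof. by rewrite normCK. Qed.

HB.instance Definition _ := NormedModule_isHilbert.Build R R[i] complex_dot_norm.

End ComplexHilbert.

Definition ell2 (R : realType) (V : choiceType) : hilbertType R :=
  hsum (fun _ : V => R[i] : hilbertType R).

Section Operators.
Variable R : realType.
Implicit Types H K : hilbertType R.

Definition opnorm H K (f : H -> K) : \bar R :=
  ereal_sup [set (rnorm (f x))%:E | x in [set x | rnorm x <= 1]].

Definition bounded_op H K (f : H -> K) := (opnorm f < +oo)%E.

Definition separable H := exists D : set H, countable D /\ dense D.

Definition unitary H K (U : H -> K) :=
  bijective U /\ forall x y, hdot (U x) (U y) = hdot x y.

Definition unitarily_equivalent d H K
    (S : 'I_d -> {linear H -> H}) (T : 'I_d -> {linear K -> K}) :=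
  exists2 U : {linear H -> K}, unitary U &
    forall j x, U (S j x) = T j (U x).

Definition commuting_tuple d H (S : 'I_d -> {linear H -> H}) :=
  (forall j, bounded_op (S j)) /\
  (forall i j x, S i (S j x) = S j (S i x)).

End Operators.

(* A circuit is a nonempty directed cycle of distinct vertices; loops are
   circuits of length one. *)
Record rdtree := RDTree {
  vertex :> countType;
  edge : rel vertex;
  root : vertex;
  tree_acyclic : forall c : seq vertex, ucycle edge c -> c = [::];
  tree_connected : forall u v : vertex,
    exists2 p, path (fun x y => edge x y || edge y x) u p & last u p = v;
  root_orphan : forall u, ~~ edge u root;
  parent_unique : forall v, v != root -> exists! u, edge u v
}.
Arguments root : clear implicits.

(* Only meaningful for [v != root T]; by convention [par (root T) = root T]. *)
Definition par (T : rdtree) (v : T) : T := xget (root T) [set u | edge u v].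

Lemma parP (T : rdtree) (v : T) : v != root T -> edge (par v) v.
Proof. by move=> /parent_unique[u [uv _]]; rewrite /par; case: xgetP => [//|/(_ u)]. Qed.

Section CartesianProduct.
Variables (d : nat) (T : 'I_d -> rdtree).

Definition pvertex := {dffun forall j : 'I_d, T j}.

Definition pedge (v w : pvertex) :=
  exists k, edge (v k) (w k) /\ forall l, l != k -> v l = w l.

Definition proot : pvertex := finfun (fun j => root (T j)).

(* [ppar j v] replaces the [j]-th coordinate of [v] by its parent. *)
Definition ppar (j : 'I_d) (v : pvertex) : pvertex :=
  finfun (fun i => if i == j then par (v i) else v i).

Lemma pedgeP (v w : pvertex) :
  pedge v w <-> exists j, w j != root (T j) /\ v = ppar j w.
Proof.
split=> [[j [e vw]]|[j [wj ->]]].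
  have wj : w j != root (T j).
    by apply: contraTneq e => ->; exact: root_orphan.
  exists j; split=> //; apply/ffunP => i; rewrite ffunE; case: eqVneq => [->|/vw//].
  have [u [_ uP]] := parent_unique wj.
  by rewrite -(uP _ e); apply: uP; exact: parP.
exists j; rewrite ffunE eqxx; split; first exact: parP.
by move=> l /negbTE lj; rewrite ffunE lj.
Qed.

(* The values of [lam j] at vertices [v] with [v j = root (T j)], in particular
   at [proot], are never used. *)
Definition is_multishift (R : realType) (lam : 'I_d -> pvertex -> R[i])
    (S : 'I_d -> {linear ell2 R pvertex -> ell2 R pvertex}) :=
  forall j (f : ell2 R pvertex) v,
    S j f v = if v j == root (T j) then 0 else lam j v * f (ppar j v).

End CartesianProduct.

Section OperatorShift.
Variables (R : realType) (d : nat).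
Definition mindex := {ffun 'I_d -> nat}.

Definition meps (j : 'I_d) : mindex := [ffun k => nat_of_bool (k == j)].

Variables (H : mindex -> hilbertType R)
  (A : forall (j : 'I_d) (a : mindex), {linear H a -> H (a + meps j)}).

(* Every multi-index [b] with [b j <> 0] is [a + meps j] for a unique [a], so
   these two clauses determine all coordinates of [W j x]. *)
Definition is_op_multishift (W : 'I_d -> {linear hsum H -> hsum H}) :=
  forall j (x : hsum H),
    (forall a : mindex, W j x (a + meps j) = A j a (x a)) /\
    (forall a : mindex, a j = 0%N -> W j x a = 0).

(* [a + meps j + meps i] and [a + meps i + meps j] are equal but not
   convertible, hence the transport along [addrAC]. *)
Definition commuting_weights :=
  (forall j, (ereal_sup [set opnorm (A j a) | a in [set: mindex]] < +oo)%E) /\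
  (forall (a : mindex) i j (x : H a),
    A i (a + meps j) (A j a x) =
    ecast b (H b) (addrAC a (meps i) (meps j)) (A j (a + meps i) (A i a x))).

End OperatorShift.

(* Main.v *)
From HB Require Import structures.
Require Import Defs.
From mathcomp Require Import all_boot all_order all_algebra.
From mathcomp Require Import all_classical all_reals topology normedtype.
From mathcomp Require Import complex.
From mathcomp Require Import finmap sesquilinear ereal esum.

(** The depth of a vertex [v] of the product is the multi-index whose [j]-th
entry is the distance of [v j] from the root of the [j]-th tree.  Passing to
the [j]-th parent lowers it by exactly [meps j], so [S j] maps the functions
supported on the vertices of depth [a] to functions supported on the vertices
of depth [a + meps j] ([multishift_support]).  The vertices are partitioned
according to their depth, hence l^2 of the vertex set is the orthogonal sum of
the spaces [H a] of square-summable functions on the vertices of depth [a],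
and in this decomposition [S j] is the operator-valued shift whose weights are
its blocks [H a -> H (a + meps j)].

The decomposition is the unitary [split_fibres], available for any map [p] out
of an index set: it is isometric because a sum of nonnegative terms may be
computed fibre by fibre ([esum_fibres]), it has the inverse [glue_fibres], and
an isometry preserves inner products by polarization ([isometry_hdot]).  A
block is [S j] between an isometric inclusion and a contractive restriction,
so its norm is at most that of [S j]; the blocks commute because the inclusion
turns them into [S j] itself ([ext_block]).  Each [H a] is separable because
there are countably many vertices ([separable_ell2]). *)

Set Implicit Arguments.
Unset Strict Implicit.
Unset Printing Implicit Defensive.

Import Order.TTheory GRing.Theory Num.Theory.
Import numFieldNormedType.Exports.

Local Open Scope classical_set_scope.
Local Open Scope ring_scope.

(** * Norms in orthogonal sums *)

Section SumNorm.
Variables (R : realType) (I : choiceType) (H : I -> hilbertType R).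

Lemma esum_rnorm (x : hsum H) :
  (\esum_(i in [set: I]) (rnorm (x i) ^+ 2)%:E = (rnorm x ^+ 2)%:E)%E.
Proof.
apply/eqP; rewrite eq_le; apply/andP; split.
  apply: ge_ereal_sup => _ [A [finA _] <-].
  by rewrite fsbig_finite//= sumEFin lee_fin hsum_norm_ge.
set s := (\esum_(i in _) _)%E.
have s0 : (0 <= s)%E by
  apply: esum_ge0 => i _; rewrite lee_fin exprn_ge0// rnorm_ge0.
have sfin : s \is a fin_num by rewrite ge0_fin_numE// hsum_sqr.
rewrite -(fineK sfin) lee_fin -[leRHS]sqr_sqrtr ?fine_ge0//.
rewrite ler_pXn2r ?nnegrE ?rnorm_ge0 ?sqrtr_ge0//.
apply: hsum_norm_le; first exact: sqrtr_ge0.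
move=> A; rewrite sqr_sqrtr ?fine_ge0// -lee_fin fineK// -sumEFin.
apply: ereal_sup_ubound; exists [set` A]; first by split.
by rewrite fsbig_finite//= set_fsetK.
Qed.

End SumNorm.

(** * Isometries preserve inner products *)

Section Isometries.
Variables (R : realType) (H K : hilbertType R) (U : {linear H -> K}).

(** Polarization: expanding the norms of [x + y] and ['i *: x + y] shows that
[U] preserves twice the real part and twice the imaginary part of
[hdot x y]. *)
Lemma isometry_hdot : (forall x, rnorm (U x) = rnorm x) ->
  forall x y, hdot (U x) (U y) = hdot x y.
Proof.
move=> isoU.
have sqU x : hdot (U x) (U x) = hdot x x by rewrite !hdot_rnorm isoU.
have key x y :
    hdot (U x) (U y) + (hdot (U x) (U y))^* = hdot x y + (hdot x y)^*.
  have := sqU (x + y); rewrite linearD !dnormD/= !sqU.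
  exact: addrI.
move=> x y; have := key x y; have := key ('i *: x) y.
rewrite linearZ_LR !linearZl_LR/= !rmorphM/= conjCi !mulNr -!mulrBr.
move=> /(mulfI (neq0Ci _)) hB hD.
have double (z : R[i]) : z = ((z - z^*) + (z + z^*)) / 2.
  by rewrite addrACA addNr addr0 -mulr2n -[z *+ 2]mulr_natr mulfK ?pnatr_eq0.
by rewrite [LHS]double [RHS]double hB hD.
Qed.

End Isometries.

(** * Decomposing l^2 along the fibres of a map *)

Section Fibres.
Variables (R : realType) (V I : choiceType) (p : V -> I).

Definition fibre (a : I) : choiceType := {v : V | p v == a}.

Lemma esum_fibres (g : V -> \bar R) : (forall v, 0 <= g v)%E ->
  (\esum_(v in [set: V]) g v =
   \esum_(a in [set: I]) \esum_(w in [set: fibre a]) g (\val w))%E.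
Proof.
move=> g0.
(* A sum over [V] is a sum over the graph of [p], which is fibred over [I]. *)
have graph_bij : set_bij [set: V] ([set: I] `*`` (fun a => p @^-1` [set a]))
    (fun v => (p v, v)).
  by split=> // [v w _ _ []|[_ v] [/= _ <-]]; last exists v.
have -> : (\esum_(v in [set: V]) g v =
    \esum_(a in [set: I]) \esum_(v in p @^-1` [set a]) g v)%E.
  by rewrite (esum_esum (a := fun=> g))//
    (reindex_esum _ _ _ (fun k => g k.2) graph_bij).
apply: eq_esum => a _; apply: reindex_esum; split.
- by move=> w _ /=; exact/eqP/(valP w).
- by move=> w w' _ _; exact: val_inj.
- by move=> v /= /eqP va; exists (exist _ v va).
Qed.

Lemma restr_subproof a (f : ell2 R V) :
  (\esum_(w in [set: fibre a]) (rnorm (f (\val w)) ^+ 2)%:E < +oo)%E.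
Proof.
apply: le_lt_trans (hsum_sqr f).
rewrite (esum_fibres (fun v => _)); last first.
  by move=> v; rewrite lee_fin exprn_ge0// rnorm_ge0.
apply: esum_ge; exists [set a]; first by split; [exact: finite_set1|].
by rewrite fsbig_set1.
Qed.

Definition restr a (f : ell2 R V) : ell2 R (fibre a) :=
  HSum (restr_subproof a f).

Fact restr_linear a : linear (restr a).
Proof. by move=> c f g; exact: hsum_ext. Qed.

HB.instance Definition _ a := GRing.isLinear.Build R[i] (ell2 R V)
  (ell2 R (fibre a)) _ (restr a) (@restr_linear a).

Lemma rnorm_fibres (f : ell2 R V) :
  (\esum_(a in [set: I]) (rnorm (restr a f) ^+ 2)%:E = (rnorm f ^+ 2)%:E)%E.
Proof.
rewrite -[RHS]esum_rnorm [RHS]esum_fibres; last first.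
  by move=> v; rewrite lee_fin exprn_ge0// rnorm_ge0.
by apply: eq_esum => a _; rewrite -esum_rnorm.
Qed.

Lemma rnorm_restr_le a (f : ell2 R V) : rnorm (restr a f) <= rnorm f.
Proof.
rewrite -(@ler_pXn2r _ 2)// ?nnegrE ?rnorm_ge0// -lee_fin -rnorm_fibres.
apply: esum_ge; exists [set a]; first by split; [exact: finite_set1|].
by rewrite fsbig_set1.
Qed.

Definition ext_fun a (f : ell2 R (fibre a)) (v : V) : R[i] :=
  oapp (f : fibre a -> R[i]) 0 (insub v).

Lemma esum_ext a (f : ell2 R (fibre a)) :
  (\esum_(v in [set: V]) (rnorm (ext_fun f v) ^+ 2)%:E =
   (rnorm f ^+ 2)%:E)%E.
Proof.
rewrite -[RHS]esum_rnorm.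
transitivity (\esum_(v in (\val : fibre a -> V) @` [set: fibre a])
    (rnorm (ext_fun f v) ^+ 2)%:E)%E.
  rewrite [RHS]esum_mkcond; apply: eq_esum => v _; case: ifPn => //.
  rewrite notin_setE /ext_fun; case: insubP => [w _ wv|_ _] /=.
    by case; exists w.
  by rewrite /rnorm normr0 expr0n.
rewrite esum_image; last by move=> w w' _ _; exact: val_inj.
by apply: eq_esum => w _; rewrite /ext_fun valK.
Qed.

Fact ext_subproof a (f : ell2 R (fibre a)) :
  (\esum_(v in [set: V]) (rnorm (ext_fun f v) ^+ 2)%:E < +oo)%E.
Proof. by rewrite esum_ext ltry. Qed.

Definition ext a (f : ell2 R (fibre a)) : ell2 R V := HSum (ext_subproof f).

Lemma ext_val a (f : ell2 R (fibre a)) (w : fibre a) : ext f (\val w) = f w.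
Proof. by rewrite /= /ext_fun valK. Qed.

Lemma ext_out a (f : ell2 R (fibre a)) v : p v != a -> ext f v = 0.
Proof. by move=> va; rewrite /= /ext_fun insubN. Qed.

Fact ext_linear a : linear (@ext a).
Proof.
move=> c f g; apply: hsum_ext => v; rewrite hsumDE hsumZE.
have [va|va] := boolP (p v == a).
  by rewrite -[v]/(\val (exist _ v va : fibre a)) !ext_val.
by rewrite !ext_out// scaler0 addr0.
Qed.

HB.instance Definition _ a := GRing.isLinear.Build R[i] (ell2 R (fibre a))
  (ell2 R V) _ (@ext a) (@ext_linear a).

Lemma rnorm_ext a (f : ell2 R (fibre a)) : rnorm (ext f) = rnorm f.
Proof.
apply/eqP; rewrite -(@eqrXn2 _ 2)// ?rnorm_ge0//; apply/eqP/EFin_inj.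
by rewrite -esum_rnorm esum_ext.
Qed.

Lemma ext_restr a (f : ell2 R V) : (forall v, p v != a -> f v = 0) ->
  ext (restr a f) = f.
Proof.
move=> f0; apply: hsum_ext => v; have [va|va] := boolP (p v == a).
  by rewrite -[v]/(\val (exist _ v va : fibre a)) ext_val.
by rewrite ext_out// f0.
Qed.

Lemma restr_ext a (f : ell2 R (fibre a)) : restr a (ext f) = f.
Proof. by apply: hsum_ext => w; exact: ext_val. Qed.

Lemma ext_inj a : injective (@ext a).
Proof. exact: can_inj (@restr_ext a). Qed.

(** Equal indices have the same fibre, so the transports in [commuting_weights]
disappear once the vectors are viewed in the l^2 space of [V]. *)
Lemma ext_ecast a b (e : a = b) (f : ell2 R (fibre a)) :
  ext (ecast c (ell2 R (fibre c)) e f) = ext f.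
Proof. by case: b / e. Qed.

Local Notation H := (fun a => ell2 R (fibre a)).

Fact split_subproof (f : ell2 R V) :
  (\esum_(a in [set: I]) (rnorm (restr a f) ^+ 2)%:E < +oo)%E.
Proof. by rewrite rnorm_fibres ltry. Qed.

Definition split_fibres (f : ell2 R V) : hsum H := HSum (split_subproof f).

Fact split_fibres_linear : linear split_fibres.
Proof. by move=> c f g; apply: hsum_ext => a; exact: restr_linear. Qed.

HB.instance Definition _ := GRing.isLinear.Build R[i] (ell2 R V) (hsum H) _
  split_fibres split_fibres_linear.

Definition glue_fun (x : hsum H) (v : V) : R[i] :=
  x (p v) (exist _ v (eqxx (p v))).

Lemma glue_funE (x : hsum H) a (w : fibre a) : glue_fun x (\val w) = x a w.
Proof.
case: w => v va; rewrite /glue_fun /=; move: (va); move/eqP: va => va.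
by case: a / va => va; congr (x _ _); exact: val_inj.
Qed.

Fact glue_subproof (x : hsum H) :
  (\esum_(v in [set: V]) (rnorm (glue_fun x v) ^+ 2)%:E < +oo)%E.
Proof.
rewrite esum_fibres; last by move=> v; rewrite lee_fin exprn_ge0// rnorm_ge0.
apply: le_lt_trans (hsum_sqr x); apply: le_esum => a _.
by rewrite -esum_rnorm; apply: le_esum => w _; rewrite glue_funE.
Qed.

Definition glue_fibres (x : hsum H) : ell2 R V := HSum (glue_subproof x).

Lemma split_fibresK : cancel split_fibres glue_fibres.
Proof. by move=> f; exact: hsum_ext. Qed.

Lemma glue_fibresK : cancel glue_fibres split_fibres.
Proof.
by move=> x; apply: hsum_ext => a; apply: hsum_ext => w; exact: glue_funE.
Qed.

Fact glue_fibres_linear : linear glue_fibres.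
Proof. exact: (can2_linear split_fibresK glue_fibresK). Qed.

HB.instance Definition _ := GRing.isLinear.Build R[i] (hsum H) (ell2 R V) _
  glue_fibres glue_fibres_linear.

Lemma split_fibres_unitary : unitary split_fibres.
Proof.
split; first exact: Bijective split_fibresK glue_fibresK.
apply: isometry_hdot => f.
apply/eqP; rewrite -(@eqrXn2 _ 2)// ?rnorm_ge0//; apply/eqP/EFin_inj.
by rewrite -esum_rnorm rnorm_fibres.
Qed.

End Fibres.

(** * Separability of l^2 over a countable set *)

Section Separability.
Variable R : realType.

Lemma rat_approx (t : R) (e : R) : 0 < e -> exists q : rat, `|t - ratr q| <= e.
Proof.
move=> e0; have [q] : exists q : rat, ratr q \in `](t - e), (t + e)[.
  by apply: rat_in_itvoo; rewrite ltrBlDr -addrA ltrDl addr_gt0.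
rewrite in_itv/= => /andP[tq qt]; exists q.
by rewrite distrC ler_distl !ltW.
Qed.

Definition crat (c : rat * rat) : R[i] := (ratr c.1 +i* ratr c.2)%C.

Lemma crat_approx (z : R[i]) (e : R) : 0 < e ->
  exists c : rat * rat, rnorm (z - crat c) ^+ 2 <= e.
Proof.
move=> e0; have t0 : 0 < Num.sqrt e / 2 by rewrite divr_gt0// sqrtr_gt0.
have [q qP] := rat_approx (complex.Re z) t0.
have [r rP] := rat_approx (complex.Im z) t0.
exists (q, r); rewrite -[leRHS]sqr_sqrtr ?(ltW e0)//.
rewrite ler_pXn2r ?nnegrE ?rnorm_ge0 ?sqrtr_ge0//.
rewrite -lecR -rnormE (le_trans (ImRe_norm_le _))// lecR.
case: z qP rP => zr zi /= qP rP.
by rewrite (le_trans (lerD qP rP))// -splitr.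
Qed.

Section FiniteSupport.
Variable I : choiceType.
Implicit Types (A B : {fset I}).

Lemma fsum_le_support (u : I -> R) A B : (forall i, 0 <= u i) ->
  (forall i, i \notin A -> u i = 0) -> \sum_(i <- B) u i <= \sum_(i <- A) u i.
Proof.
move=> u0 uA; apply: le_trans (fsum_le_sub u0 (fsubsetUl B A)) _.
rewrite -subr_le0 fsum_sub ?fsubsetUr// big_seq big1// => i.
by rewrite inE => /andP[/uA].
Qed.

(** Association lists are used as codes for the finitely supported vectors with
complex rational entries because they form a countable type.  The index of an
absent key is the length of the list, where [nth] returns the default value
[(0, 0)], that is, the entry zero. *)
Definition rat_fun (s : seq (I * (rat * rat))) (i : I) : R[i] :=
  crat (nth (0, 0) (unzip2 s) (index i (unzip1 s))).

Lemma rat_fun_out s i : i \notin unzip1 s -> rat_fun s i = 0.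
Proof.
move=> si; rewrite /rat_fun memNindex// size_map nth_default ?size_map//.
by rewrite /crat/= rmorph0.
Qed.

Lemma rat_fun_graph A (c : I -> rat * rat) i :
  rat_fun [seq (j, c j) | j <- A] i = if i \in A then crat (c i) else 0.
Proof.
have uA : unzip1 [seq (j, c j) | j <- A] = A.
  by rewrite /unzip1 -map_comp map_id.
case: ifPn => iA; last by rewrite rat_fun_out// uA.
rewrite /rat_fun uA /unzip2 -map_comp (nth_map i) ?index_mem//.
by rewrite nth_index.
Qed.

Fact rat_fun_subproof s :
  (\esum_(i in [set: I]) (rnorm (rat_fun s i) ^+ 2)%:E < +oo)%E.
Proof.
apply/esum_ltyP.
exists (\sum_(i <- [fset j in unzip1 s]%fset) rnorm (rat_fun s i) ^+ 2) => B.
apply: fsum_le_support => i; first by rewrite exprn_ge0// rnorm_ge0.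
by rewrite inE/= => si; rewrite rat_fun_out// /rnorm normr0 expr0n.
Qed.

Definition rat_vec s : ell2 R I := HSum (rat_fun_subproof s).

Lemma rnorm_tail (x : ell2 R I) (e : R) : 0 < e ->
  exists A, rnorm x ^+ 2 - e <= \sum_(i <- A) rnorm (x i) ^+ 2.
Proof.
move=> e0; apply: contrapT => /forallNP xA.
suff : rnorm x ^+ 2 <= rnorm x ^+ 2 - e by rewrite leNgt ltrBlDr ltrDl e0.
rewrite -lee_fin -[in leLHS]esum_rnorm.
apply: ge_ereal_sup => _ [A [finA _] <-].
rewrite fsbig_finite//= sumEFin lee_fin ltW// ltNge; apply/negP.
exact: xA.
Qed.

(** Half of [e ^+ 2] pays for the entries of [x] outside a finite set [A], the
other half, divided evenly among the elements of [A], for rounding the entries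
inside [A]. *)
Lemma rat_vec_approx (x : ell2 R I) (e : R) : 0 < e ->
  exists s, rnorm (x - rat_vec s) <= e.
Proof.
move=> e0; pose d := e ^+ 2 / 2.
have d0 : 0 < d by rewrite divr_gt0// exprn_gt0.
have [A xA] := rnorm_tail x d0.
(* The successor keeps the share [d / m] meaningful when [A] is empty. *)
pose m : R := (#|` A|.+1)%:R.
have m0 : 0 < m by rewrite ltr0n.
have /choice[c cP] : forall i, exists c : rat * rat,
    rnorm (x i - crat c) ^+ 2 <= d / m.
  by move=> i; apply: crat_approx; rewrite divr_gt0.
exists [seq (j, c j) | j <- A]; apply: hsum_norm_le; first exact: ltW.
set f := rat_vec _ => B.
pose u i := rnorm ((x - f) i) ^+ 2.
have u0 i : 0 <= u i by rewrite exprn_ge0// rnorm_ge0.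
rewrite (le_trans (fsum_le_sub u0 (fsubsetUl B A)))//.
rewrite -[leLHS](subrK (\sum_(i <- A) u i)) fsum_sub ?fsubsetUr//.
rewrite [leRHS]splitr lerD//.
  rewrite (eq_big_seq (fun i => rnorm (x i) ^+ 2)); last first.
    move=> i; rewrite inE => /andP[iA _].
    by rewrite /u hsumDE hsumNE /= rat_fun_graph (negbTE iA) subr0.
  rewrite -fsum_sub ?fsubsetUr// lerBlDr -lerBlDl.
  apply: le_trans xA; rewrite lerB//; exact: hsum_norm_ge.
rewrite big_seq (le_trans (y := \sum_(i <- A) (d / m)))//.
  rewrite [leRHS]big_seq; apply: ler_sum => i iA.
  by rewrite /u hsumDE hsumNE /= rat_fun_graph iA.
rewrite big_const_seq count_predT iter_addr_0 -[leLHS]mulr_natr.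
rewrite mulrAC ler_pdivrMr// ler_pM2l// ler_nat.
exact: leqnSn.
Qed.

End FiniteSupport.

Lemma separable_ell2 (I : countType) : separable (ell2 R I).
Proof.
exists (range (@rat_vec I)); split.
  exact: sub_countable (card_image_le _ _) (countableP _).
move=> O [x Ox] Oopen.
have /nbhs_ballP[_ /posC[e e0 ->] xeO] : nbhs x O by exact: open_nbhs_nbhs.
have [s xs] := rat_vec_approx x (divr_gt0 e0 (ltr0Sn R 1)).
exists (rat_vec s); split; last by exists s.
apply: xeO; rewrite -ball_normE /= rnormE ltcR (le_lt_trans xs)//.
by rewrite ltr_pdivrMr// ltr_pMr// ltr1n.
Qed.

End Separability.

(** * Blocks of an operator *)

Section Blocks.
Variables (R : realType) (V I : choiceType) (p : V -> I).
Variable S : {linear ell2 R V -> ell2 R V}.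

Definition block (a b : I) :
  {linear ell2 R (fibre p a) -> ell2 R (fibre p b)} :=
  restr p b \o S \o @ext R V I p a.

Lemma opnorm_block_le a b : (opnorm (block a b) <= opnorm S)%E.
Proof.
apply: ge_ereal_sup => _ [x /= x1 <-].
apply: le_trans (_ : (rnorm (S (ext x)))%:E <= _)%E.
  by rewrite lee_fin rnorm_restr_le.
by apply: ereal_sup_ubound; exists (ext x) => //=; rewrite rnorm_ext.
Qed.

Definition transported : {linear hsum (fun a => ell2 R (fibre p a)) ->
    hsum (fun a => ell2 R (fibre p a))} :=
  @split_fibres R V I p \o S \o @glue_fibres R V I p.

End Blocks.

(** * Depth of a vertex *)

Section Depth.
Variable T : rdtree.
Implicit Types u v : T.

Lemma edge_par u v : edge u v -> par v = u.
Proof.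
move=> uv; have vr : v != Defs.root T.
  by apply: contraTneq uv => ->; exact: root_orphan.
have [w [_ wP]] := parent_unique vr.
by rewrite -(wP _ uv); apply/esym/wP; exact: parP.
Qed.

(** An undirected step goes either to a child or to the parent, and neither
destroys the property that iterating [par] leads to the root; as the tree is
connected, the property propagates from the root to every vertex. *)
Lemma iter_par_root v : exists n, iter n (@par T) v == Defs.root T.
Proof.
have [s sP <-] := tree_connected (Defs.root T) v.
have : exists n, iter n (@par T) (Defs.root T) == Defs.root T by exists 0%N.
elim: s {1 2 4}(Defs.root T) sP => [|y s IH] x //= /andP[/orP xy sP] [n xn].
apply: IH sP _.
case: xy => [xy|yx]; first by exists n.+1; rewrite iterSr (edge_par xy).
(* A step from [x] to its parent; with [n = 0], [x] is the root, an orphan. *)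
case: n xn => [/eqP xr|n xn]; last by exists n; rewrite -(edge_par yx) -iterSr.
by move: yx; rewrite -[x]/(iter 0 (@par T) x) xr (negbTE (root_orphan _)).
Qed.

Definition depth v := ex_minn (iter_par_root v).

Lemma depth_eq0 v : (depth v == 0%N) = (v == Defs.root T).
Proof.
rewrite /depth; case: ex_minnP => n nP nmin; apply/eqP/eqP => [n0|vr].
  by apply/eqP; move: nP; rewrite n0.
by apply/eqP; rewrite -leqn0; apply: nmin; rewrite vr.
Qed.

Lemma depth_par v : v != Defs.root T -> depth v = (depth (par v)).+1.
Proof.
move=> vr; have := depth_eq0 v; rewrite (negbTE vr) /depth.
case: ex_minnP => [[//|n]] nP nmin _; case: ex_minnP => m mP mmin; congr S.
apply/eqP; rewrite eqn_leq mmin -?iterSr// andbT.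
by rewrite -ltnS nmin// iterSr.
Qed.

End Depth.

Section ProductDepth.
Variables (d : nat) (T : 'I_d -> rdtree).
Implicit Types (v : pvertex T) (j : 'I_d).

Definition pdepth v : mindex d := [ffun j => depth (v j)].

Lemma pdepth_ppar j v : v j != Defs.root (T j) ->
  pdepth v = pdepth (ppar j v) + meps j.
Proof.
move=> vj; apply/ffunP => i; rewrite !ffunE; case: (eqVneq i j) => [->|_].
  by rewrite (depth_par vj) addrC.
by rewrite addr0.
Qed.

Lemma pdepth_pparE j v (a : mindex d) : v j != Defs.root (T j) ->
  (pdepth (ppar j v) == a) = (pdepth v == a + meps j).
Proof.
move=> vj; rewrite (pdepth_ppar vj); apply/eqP/eqP => [->//|/ffunP va].
by apply/ffunP => i; have := va i; rewrite !ffunE => /addIn.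
Qed.

Lemma pdepth_nonroot j v (a : mindex d) :
  pdepth v = a + meps j -> v j != Defs.root (T j).
Proof.
move=> /ffunP/(_ j); rewrite !ffunE eqxx -depth_eq0 => ->.
by rewrite -lt0n addrC.
Qed.

End ProductDepth.

(** * Multishifts raise the depth *)

Section ShiftGrading.
Variables (R : realType) (d : nat) (T : 'I_d -> rdtree).
Variables (lam : 'I_d -> pvertex T -> R[i]).
Variables (S : 'I_d -> {linear ell2 R (pvertex T) -> ell2 R (pvertex T)}).
Hypothesis SE : is_multishift lam S.

Local Notation dep := (@pdepth d T).
Local Notation fib := (fibre dep).
Local Notation H := (fun a : mindex d => ell2 R (fib a)).

Lemma multishift_support j a (f : ell2 R (pvertex T)) :
  (forall v, pdepth v != a -> f v = 0) ->
  forall v, pdepth v != a + meps j -> S j f v = 0.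
Proof.
move=> f0 v va; rewrite SE; case: eqVneq => // vj.
by rewrite f0 ?mulr0// pdepth_pparE.
Qed.

(** [restr] loses nothing here, since [S j] maps functions on depth [a] to
functions on depth [a + meps j]. *)
Lemma ext_block j a (x : H a) :
  ext (block dep (S j) a (a + meps j) x) = S j (ext x).
Proof. by apply: ext_restr; apply: multishift_support => v; exact: ext_out. Qed.

(** Vertices of depth [a + meps j] have their [j]-th parent at depth [a], so
[S j f] there sees only the values of [f] at depth [a]. *)
Lemma restr_multishift j a (f g : ell2 R (pvertex T)) :
  restr dep a f = restr dep a g :> H a ->
  restr dep (a + meps j) (S j f) = restr dep (a + meps j) (S j g)
    :> H (a + meps j).
Proof.
move=> fg; apply: hsum_ext => w /=; have /eqP wa := valP w; rewrite !SE.
have wj := pdepth_nonroot wa; rewrite (negbTE wj).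
have ua : pdepth (ppar j (\val w)) == a by rewrite pdepth_pparE// wa.
congr (_ * _).
exact: (congr1 (fun h : H a => h (exist _ (ppar j (\val w)) ua)) fg).
Qed.

Lemma transported_op_multishift :
  is_op_multishift (fun j a => block dep (S j) a (a + meps j))
    (fun j => transported dep (S j)).
Proof.
move=> j x; split=> [a|a aj].
  apply: restr_multishift; rewrite restr_ext.
  by apply: hsum_ext => w; exact: glue_funE.
apply: hsum_ext => w; rewrite /= SE.
have /eqP/ffunP/(_ j) := valP w; rewrite ffunE aj => /eqP.
by rewrite depth_eq0 => ->.
Qed.

Hypothesis Scomm : commuting_tuple S.

(** The inclusions into l^2 are injective and turn blocks into [S i] and [S j],
which commute. *)
Lemma block_commuting :
  commuting_weights (fun j a => block dep (S j) a (a + meps j)).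
Proof.
split=> [j|a i j x].
  apply: le_lt_trans (Scomm.1 j); apply: ge_ereal_sup => _ [a _ <-].
  exact: opnorm_block_le.
apply: ext_inj; rewrite ext_ecast !ext_block; exact: Scomm.2.
Qed.

End ShiftGrading.

(** * The equivalence with an operator-valued multishift *)

Theorem proposition2p6 (R : realType) (d : nat) (hd : (0 < d)%N)
    (T : 'I_d -> rdtree) (lam : 'I_d -> pvertex T -> R[i])
    (S : 'I_d -> {linear ell2 R (pvertex T) -> ell2 R (pvertex T)})
    (SE : is_multishift lam S) (Scomm : commuting_tuple S) :
  exists (H : mindex d -> hilbertType R)
    (A : forall (j : 'I_d) (a : mindex d), {linear H a -> H (a + meps j)})
    (W : 'I_d -> {linear hsum H -> hsum H}),
    [/\ forall a, separable (H a),
        forall j a, bounded_op (A j a),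
        is_op_multishift A W,
        commuting_weights A &
        unitarily_equivalent S W].
Proof.
pose p := @pdepth d T.
exists (fun a => ell2 R (fibre p a)), (fun j a => block p (S j) a (a + meps j)),
  (fun j => transported p (S j)); split.
- move=> a; exact: (separable_ell2 R {v : pvertex T | p v == a}).
- by move=> j a; exact: le_lt_trans (opnorm_block_le _ _ _ _) (Scomm.1 j).
- exact: transported_op_multishift SE.
- exact: block_commuting SE Scomm.
- exists (@split_fibres R _ _ p); first exact: split_fibres_unitary.
  by move=> j x /=; rewrite split_fibresK.
Qed.
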